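(* Let $X$ be a locally compact Hausdorff space and let $f\in C_0(X)$ be non-zero. Then $f$ is smooth if and only if $M_f$ is a singleton set.
   Context: $\mathbb{K}$ is $\mathbb{R}$ or $\mathbb{C}$. $C_0(X)$ is the space of continuous functions $X\to\mathbb{K}$ vanishing at infinity, with the supremum norm $\|\cdot\|$. For $f\in C_0(X)$, $M_f:=\{x\in X:|f(x)|=\|f\|\}$. For a normed space $\mathbb{X}$ over $\mathbb{K}$ with continuous dual $\mathbb{X}^*$ and non-zero $x\in\mathbb{X}$, the set of support functionals is $J(x):=\{\varphi\in\mathbb{X}^*:\|\varphi\|=1,\ \varphi(x)=\|x\|\}$; a non-zero $x$ is smooth if $J(x)$ is a singleton. *)

(* Defs.v *)
From HB Require Import structures.
From mathcomp Require Import all_boot all_order all_algebra.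
From mathcomp Require Import all_classical all_reals all_analysis.
From mathcomp Require Import complex.

Set Implicit Arguments.
Unset Strict Implicit.
Unset Printing Implicit Defensive.

Import Order.TTheory GRing.Theory Num.Theory.
Import numFieldNormedType.Exports.
Local Open Scope classical_set_scope.
Local Open Scope ring_scope.

Variant scalar_kind := RealScalars | ComplexScalars.

Definition scalars (R : realType) (k : scalar_kind) : numFieldType :=
  match k with
  | RealScalars => R
  | ComplexScalars => R[i]
  end.
Arguments scalars : simpl never.

Definition singleton_set (T : Type) (A : set T) := exists a, A = [set a].

Section support_functionals.
Variables (K : numFieldType) (V : normedModType K).

Definition dual : set (V -> K) := [set phi : V -> K | scalar phi /\ continuous phi].

(* As in any normedModType K, norms are elements of K, also when K is complex;
   the supremum is taken for the (then partial) order of K, for which a nonempty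
   set of reals has the same least upper bound as in the real line. The default
   value 0 is only reached if there is no supremum, which does not happen for a
   continuous functional when K is the real or the complex field. *)
Definition dual_norm (phi : V -> K) : K :=
  supremum (0 : K) [set `|phi v| | v in [set v | `|v| <= 1]].

Definition support_functionals (x : V) : set (V -> K) :=
  [set phi : V -> K | [/\ dual phi, dual_norm phi = 1 & phi x = `|x|]].

Definition smooth (x : V) := x != 0 /\ singleton_set (support_functionals x).

End support_functionals.

Section C0.
Variables (K : numFieldType) (X : topologicalType).

Definition vanishes_at_infinity (f : X -> K) :=
  forall e : K, 0 < e -> compact [set x | e <= `|f x|].

Definition C0_pred : {pred X -> K} :=
  mem [set f : X -> K | continuous f /\ vanishes_at_infinity f].

Lemma closed_le_norm (f : X -> K) (e : K) :
  continuous f -> 0 < e -> closed [set x | e <= `|f x|].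
Proof.
move=> cf e0; rewrite -openC openE => x /= /negP.
rewrite -real_ltNge ?normr_real ?gtr0_real// => fxe.
have d0 : 0 < e - `|f x| by rewrite subr_gt0.
have /cvgrPdist_lt/(_ _ d0) := cf x.
apply: filterS => y fxy /=; apply/negP.
rewrite -real_ltNge ?normr_real ?gtr0_real//.
have -> : f y = f x - (f x - f y) by rewrite opprB addrC subrK.
rewrite (le_lt_trans (ler_normB _ _))//.
by rewrite -ltrBrDl.
Qed.

Lemma C0_submod_closed : submod_closed C0_pred.
Proof.
split.
  rewrite inE; split; first exact: cst_continuous.
  move=> e e0; rewrite (_ : mkset _ = set0); first exact: compact0.
  by rewrite -subset0 => x /=; rewrite normr0 lt_geF.
move=> a f g /[!inE] -[cf vf] [cg vg].
have cfg : continuous (a *: f + g).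
  by move=> x; apply: cvgD; [apply: cvgZr; exact: cf|exact: cg].
split=> // e e0.
pose A := [set x | e / 2 / (`|a| + 1) <= `|f x|].
pose B := [set x | e / 2 <= `|g x|].
have a1 : 0 < `|a| + 1 by rewrite ltr_wpDl.
have e2 : 0 < e / 2 by rewrite divr_gt0.
have : compact (A `|` B).
  by apply: compactU; [apply: vf; rewrite divr_gt0|exact: vg].
move=> cAB; apply: subclosed_compact (closed_le_norm cfg e0) cAB _.
move=> x /= ex; rewrite /A /B /setU /=; apply/orP; apply: contraTT ex.
rewrite negb_or -!real_ltNge ?normr_real ?gtr0_real ?divr_gt0//.
move=> /andP[fx gx].
rewrite (le_lt_trans (ler_normD _ _))// (splitr e) ltr_leD ?ltW//.
rewrite normrM (@le_lt_trans _ _ ((`|a| + 1) * `|f x|))//.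
  by rewrite ler_wpM2r// lerDl.
by rewrite mulrC -ltr_pdivlMr.
Qed.

HB.instance Definition _ := GRing.isSubmodClosed.Build _ _ C0_pred
  C0_submod_closed.

Record C0 := MkC0 { C0_fun :> X -> K; C0_funP : C0_fun \in C0_pred }.

HB.instance Definition _ := [isSub for C0_fun].
HB.instance Definition _ := [Choice of C0 by <:].
HB.instance Definition _ := [SubChoice_isSubLmodule of C0 by <:].

Definition sup_norm (f : C0) : K := supremum (0 : K) (range (fun x => `|f x|)).

Lemma C0_bounded (f : C0) : exists2 M, M \is Num.real & forall x, `|f x| <= M.
Proof.
have := C0_funP f; rewrite inE => -[cf /(_ 1 ltr01) cpt].
have : \forall M \near +oo, [set x | 1 <= `|f x|] `<=` [set x | `|f x| <= M].
  move/compact_near_coveringP : cpt; apply=> x _.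
  exists ([set y | `|f x - f y| < 1], [set M | `|f x| + 1 < M]) => /=.
    split; first by have /cvgrPdist_lt/(_ _ ltr01) := cf x.
    by apply: nbhs_pinfty_gt; rewrite realD ?normr_real.
  move=> [y M] /= [yx xM].
  rewrite (le_trans _ (ltW xM))//.
  have -> : f y = f x - (f x - f y) by rewrite opprB addrC subrK.
  by rewrite (le_trans (ler_normB _ _))// lerD2l ltW.
move=> [M0 [M0r M0P]].
have M1 : M0 < `|M0| + 1.
  by rewrite (le_lt_trans (real_ler_norm M0r))// ltrDl.
exists (Num.max 1 (`|M0| + 1)) => [|x].
  by rewrite max_real// realD ?normr_real.
rewrite comparable_le_max ?real_comparable ?realD ?normr_real//.
have [x1|x1] := boolP (1 <= `|f x|); first by rewrite (M0P _ M1)// orbT.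
by rewrite ltW// real_ltNge// normr_real.
Qed.

End C0.

Lemma scalars_supremums (R : realType) (k : scalar_kind)
    (A : set (scalars R k)) (M : scalars R k) :
  A !=set0 -> A `<=` [set a | a \is Num.real] -> ubound A M ->
  supremums A !=set0.
Proof.
rewrite /scalars; case: k A M => /= A M [a Aa] Ar AM.
  exists (sup A); have hA : has_sup A by split; [exists a | exists M].
  split; first exact: sup_upper_bound.
  by move=> b Ab; apply: ge_sup => //; exists a.
pose B := [set complex.Re z | z in A].
have ReA z : A z -> (complex.Re z)%:C%C = z by move=> /Ar /= /RRe_real.
have ubAB b : ubound A b -> ubound B (complex.Re b).
  by move=> Ab _ [z Az <-]; have := Ab _ Az; rewrite lecE => /andP[].
have hB : has_sup B.
  by split; [exists (complex.Re a), a | exists (complex.Re M); exact: ubAB].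
exists (sup B)%:C%C; split.
  move=> z Az; rewrite -(ReA _ Az) lecR.
  by apply: sup_upper_bound => //; exists z.
move=> b Ab.
have /complex_realP[c bc] : b \is Num.real.
  by rewrite (ger_real (Ab _ Aa)); exact: Ar.
move: Ab; rewrite bc lecR => /ubAB /= Bc.
by apply: ge_sup => //; exists (complex.Re a), a.
Qed.

Section C0_normed.
Variables (R : realType) (k : scalar_kind) (X : topologicalType).
Let K := scalars R k.
Implicit Types f g : C0 K X.

Lemma sup_norm_ub f x : `|f x| <= sup_norm f.
Proof.
have [M Mr fM] := C0_bounded f.
have [|||s] := @scalars_supremums R k (range (fun x => `|f x|)) M.
- by exists `|f x|, x.
- by move=> _ [y _ <-] /=; exact: normr_real.
- by move=> _ [y _ <-].
move=> sP; rewrite /sup_norm /supremum; case: ifPn => [/eqP A0|_].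
  have : (range (fun x => `|f x|)) `|f x| by exists x.
  by rewrite A0.
case: xgetP => [y _ [uby _]|/(_ s)//]; by apply: uby; exists x.
Qed.

Lemma sup_norm_le f (M : K) : 0 <= M -> (forall x, `|f x| <= M) ->
  sup_norm f <= M.
Proof.
move=> M0 fM; rewrite /sup_norm /supremum; case: ifPn => // _.
by case: xgetP => // y _ [_]; apply=> _ [x _ <-].
Qed.

Lemma sup_norm_ge0 f : 0 <= sup_norm f.
Proof.
rewrite /sup_norm /supremum; case: ifPn => // /set0P[_ [x _ _]].
case: xgetP => // y _ [ub _].
by rewrite (le_trans (normr_ge0 (f x)))//; apply: ub; exists x.
Qed.

Lemma sup_normD f g : sup_norm (f + g) <= sup_norm f + sup_norm g.
Proof.
apply: sup_norm_le => [|x]; first by rewrite addr_ge0 ?sup_norm_ge0.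
by rewrite (le_trans (ler_normD _ _))// lerD// sup_norm_ub.
Qed.

Lemma sup_normZ (l : K) f : sup_norm (l *: f) = `|l| * sup_norm f.
Proof.
have ub (a : K) g : sup_norm (a *: g) <= `|a| * sup_norm g.
  apply: sup_norm_le => [|x]; first by rewrite mulr_ge0 ?sup_norm_ge0.
  by rewrite normrM ler_wpM2l// sup_norm_ub.
apply/eqP; rewrite eq_le ub/=.
have [->|l0] := eqVneq l 0; first by rewrite normr0 mul0r sup_norm_ge0.
have := ub l^-1 (l *: f); rewrite scalerA mulVf// scale1r normfV.
by rewrite mulrC ler_pdivlMr ?normr_gt0// mulrC.
Qed.

Lemma sup_norm_eq0 f : sup_norm f = 0 -> f = 0.
Proof.
move=> f0; apply/val_inj/funext => x /=; apply/normr0_eq0/le_anti.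
by rewrite normr_ge0 andbT -f0 sup_norm_ub.
Qed.

HB.instance Definition _ := Lmodule_isNormed.Build K (C0 K X)
  sup_normD sup_normZ sup_norm_eq0.

End C0_normed.

Definition norm_attaining_set (R : realType) (k : scalar_kind)
    (X : topologicalType) (f : C0 (scalars R k) X) : set X :=
  [set x | `|f x| = `|f|].

(* Main.v *)
Require Import Defs.
From mathcomp Require Import all_boot all_order all_algebra.
From mathcomp Require Import all_classical all_reals all_analysis.
From mathcomp Require Import complex.

Set Implicit Arguments.
Unset Strict Implicit.
Unset Printing Implicit Defensive.

Import Order.TTheory GRing.Theory Num.Theory.
Import numFieldNormedType.Exports.
Local Open Scope classical_set_scope.
Local Open Scope ring_scope.

(** Every point x of M_f gives a support functional of f: evaluation at x,
    multiplied by the unimodular scalar ||f|| / f(x)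
    ([point_support_functional]). The theorem says that smoothness counts these
    functionals.

    If f is smooth, M_f is nonempty because |f| attains its supremum
    ([norm_attaining_set_neq0]). If M_f had two points x and y, a Urysohn
    function h with values in the unit interval, h(y) = 0 and h(x) = 1, would
    give a function f h in C_0(X) at which the functionals of y and x take the
    values 0 and ||f|| ([scalars_urysohn], [C0_mul_bounded]), so that f would
    have two support functionals.

    Conversely let M_f = {x0} and let phi be a support functional of f. The
    point is that phi kills every g with g(x0) = 0
    ([support_functional_eq0]); applied to g - (g(x0) / f(x0)) f, this forces
    phi(g) = (||f|| / f(x0)) g(x0). No representation of the dual of C_0(X) by
    measures is involved, only the first-order behaviour of the norm: given
    e > 0, the compact set {e <= |g|} misses x0, so |f| stays below ||f|| by a
    fixed gap there ([compact_norm_lt_gap]), and ||f + t g|| <= ||f|| + |t| e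
    for small t. Choosing the phase of t such that t phi(g) = |t| |phi(g)|, the
    bound |phi(f + t g)| <= ||f + t g|| becomes |phi(g)| <= e. *)

(** * Functionals of dual norm one *)

Section dual_norm_one.
Variables (K : numFieldType) (V : normedModType K).
Implicit Types (phi : V -> K) (u v : V).

Lemma scalar0 phi : scalar phi -> phi 0 = 0.
Proof.
move=> lphi; have := lphi 1 0 0.
by rewrite scaler0 addr0 mul1r => /eqP; rewrite -subr_eq subrr eq_sym => /eqP.
Qed.

Lemma scalarZ phi a v : scalar phi -> phi (a *: v) = a * phi v.
Proof. by move=> lphi; rewrite -[a *: v]addr0 lphi scalar0// addr0. Qed.

(** Since the default value of the supremum defining the dual norm is 0, a dual
    norm equal to 1 can only come from a genuine least upper bound. *)
Lemma dual_norm1_le phi : scalar phi -> dual_norm phi = 1 ->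
  forall v, `|phi v| <= `|v|.
Proof.
move=> lphi phi1.
have ball_le v : `|v| <= 1 -> `|phi v| <= 1.
  move=> v1; move: phi1; rewrite /dual_norm /supremum.
  case: ifPn => [_ /esym/eqP|_]; first by rewrite oner_eq0.
  case: xgetP => [y _ [ub _] <-|_ /esym/eqP]; last by rewrite oner_eq0.
  by apply: ub; exists v.
move=> v; have [->|v0] := eqVneq v 0; first by rewrite scalar0// !normr0.
have v_gt0 : 0 < `|v| by rewrite normr_gt0.
have := ball_le (`|v|^-1 *: v).
rewrite normrZ normfV normr_id mulVf ?gt_eqF// => /(_ (lexx _)).
by rewrite scalarZ// normrM normfV normr_id mulrC ler_pdivrMr// mul1r.
Qed.

Lemma scalar_le_norm_continuous phi : scalar phi ->
  (forall v, `|phi v| <= `|v|) -> continuous phi.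
Proof.
move=> lphi phile v; apply/cvgrPdist_lt => e e0.
apply/nbhs_normP; exists e => //= w vw.
have -> : phi v - phi w = phi (v - w).
  by rewrite [v - w]addrC -(scaleN1r w) lphi mulN1r addrC.
exact: le_lt_trans (phile _) vw.
Qed.

(** A vector at which the bound is attained makes 1 the maximum of the values on
    the unit ball, which spares any appeal to completeness of the order. *)
Lemma dual_norm_eq1 phi u : (forall v, `|phi v| <= `|v|) ->
  `|u| = 1 -> `|phi u| = 1 -> dual_norm phi = 1.
Proof.
move=> phile u1 phiu1; rewrite /dual_norm.
have S1 : supremums [set `|phi v| | v in [set v | `|v| <= 1]] 1.
  split; first by move=> _ [v /= v1 <-]; exact: le_trans (phile v) v1.
  by move=> b; apply; exists u => //=; rewrite u1.
rewrite /supremum; case: ifPn => [/eqP A0|_].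
  have : [set `|phi v| | v in [set v | `|v| <= 1]] 1.
    by exists u => //=; rewrite u1.
  by rewrite A0.
by case: xgetP => [y _ Sy|/(_ 1)//]; exact: is_subset1_supremums Sy S1.
Qed.

End dual_norm_one.

(** * Compactness and the scalar field *)

(** This replaces the extreme value theorem, whose usual form needs a totally
    ordered codomain: the order on the complex numbers is only partial. Around
    each point x half of the gap N - |h x| works, and near-covering makes the
    choice uniform. *)
Lemma compact_norm_lt_gap (K : numFieldType) (T : topologicalType)
    (h : T -> K) (A : set T) (N : K) :
  continuous h -> compact A -> (forall x, A x -> `|h x| < N) ->
  exists2 d, 0 < d & forall x, A x -> `|h x| <= N - d.
Proof.
move=> ch cA hN.
have gap : \forall d \near (0 : K)^'+, A `<=` [set x | `|h x| <= N - d].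
  move/compact_near_coveringP : cA; apply=> x Ax.
  have e0 : 0 < (N - `|h x|) / 2 by rewrite divr_gt0// subr_gt0 hN.
  exists ([set y | `|h x - h y| < (N - `|h x|) / 2],
          [set d | d < (N - `|h x|) / 2]) => /=.
    split; first by have /cvgrPdist_lt/(_ _ e0) := ch x.
    exact: nbhs_right_lt.
  move=> [y d] /= [yx de].
  have -> : h y = h x - (h x - h y) by rewrite opprB addrC subrK.
  rewrite (le_trans (ler_normB _ _))// lerBrDr -addrA.
  rewrite -[leRHS](subrK `|h x|) addrC lerD2r [leRHS]splitr.
  by rewrite lerD ?ltW.
near (0 : K)^'+ => d; exists d; first by near: d; exact: nbhs_right_gt.
by move=> x; apply: (near gap d).
Unshelve. all: by end_near. Qed.

(** Serves to turn real Urysohn functions into scalar-valued ones, whichever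
    the scalar field. *)
Lemma real_to_scalars (R : realType) (k : scalar_kind) :
  exists iota : R -> scalars R k,
    [/\ continuous iota, iota 0 = 0, iota 1 = 1 &
        forall t, 0 <= t <= 1 -> `|iota t| <= 1].
Proof.
rewrite /scalars; case: k.
  exists id; split=> // [t|t /andP[t0 t1]]; first exact: cvg_id.
  by rewrite ger0_norm.
exists (fun t => t%:C%C); split=> //.
  move=> t; apply/cvgrPdist_lt => e e0.
  have /complex_realP[r er] := gtr0_real e0.
  move: e0; rewrite er ltcR => r0.
  have /cvgrPdist_lt/(_ _ r0) := @cvg_id _ (nbhs t).
  apply: filterS => s ts.
  rewrite -[X in `|X|](rmorphB (real_complex R)) /= normc_def/=.
  by rewrite expr0n/= addr0 sqrtr_sqr ltcR.
move=> t /andP[t0 t1].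
by rewrite normc_def/= expr0n/= addr0 sqrtr_sqr lecR ger0_norm.
Qed.

(** * Support functionals on the space of functions vanishing at infinity *)

Section C0_smoothness.
Variables (R : realType) (k : scalar_kind) (X : topologicalType).
Let K := scalars R k.
Implicit Types f g : C0 K X.

Lemma C0_continuous f : continuous f.
Proof. by have := C0_funP f; rewrite inE => -[]. Qed.

Lemma C0_vanishes f : vanishes_at_infinity f.
Proof. by have := C0_funP f; rewrite inE => -[]. Qed.

Lemma C0_norm_eval_le f x : `|f x| <= `|f|.
Proof. exact: sup_norm_ub. Qed.

Lemma C0_norm_le f (M : K) : 0 <= M -> (forall x, `|f x| <= M) -> `|f| <= M.
Proof. exact: sup_norm_le. Qed.

(** Otherwise |f| would have a gap below ||f|| on the compact set
    {||f|| / 2 <= |f|}, and it is at most ||f|| / 2 elsewhere, so the supremum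
    would be smaller than ||f||. *)
Lemma norm_attaining_set_neq0 f : f != 0 -> norm_attaining_set f !=set0.
Proof.
move=> f0; have N0 : 0 < `|f| by rewrite normr_gt0.
apply: contrapT => /forallNP nf.
have flt x : `|f x| < `|f|.
  rewrite lt_neqAle C0_norm_eval_le andbT; apply/eqP; exact: nf.
have N2 : 0 < `|f| / 2 by rewrite divr_gt0.
have [d d0 fd] := compact_norm_lt_gap (@C0_continuous f) (@C0_vanishes f _ N2)
  (fun x _ => flt x).
have cmp : `|f| / 2 >=< `|f| - d.
  by rewrite real_comparable// ?realB// ?gtr0_real.
suff : `|f| <= Num.max (`|f| / 2) (`|f| - d).
  rewrite comparable_le_max// => /orP[|].
    by rewrite {1}(splitr `|f|) gerDl (lt_geF N2).
  by rewrite lerBrDl gerDr (lt_geF d0).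
apply: C0_norm_le => [|x].
  by rewrite comparable_le_max// ltW.
rewrite comparable_le_max//.
have [x1|x1] := boolP (`|f| / 2 <= `|f x|); first by rewrite fd// orbT.
by rewrite ltW// real_ltNge// ?normr_real ?gtr0_real.
Qed.

Lemma point_support_functional f x : f != 0 -> norm_attaining_set f x ->
  support_functionals f (fun g => `|f| / f x * g x).
Proof.
rewrite /norm_attaining_set /= => f0 fx.
have N0 : `|f| != 0 by rewrite normr_eq0.
have fx0 : f x != 0 by rewrite -normr_eq0 fx.
have c1 : `| `|f| / f x| = 1 by rewrite normf_div normr_id fx divff.
have phile g : `| `|f| / f x * g x| <= `|g|.
  by rewrite normrM c1 mul1r C0_norm_eval_le.
split; last by rewrite divfK.
  have lphi : scalar (fun g => `|f| / f x * g x).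
    by move=> a u v /=; rewrite mulrDr mulrCA.
  by split=> //; exact: scalar_le_norm_continuous.
(* The functional attains its norm at f / ||f||. *)
apply: (@dual_norm_eq1 _ _ _ (`|f|^-1 *: f)) => //.
  by rewrite normrZ normfV normr_id mulVf.
by rewrite normrM c1 mul1r /= normrM normfV normr_id fx mulVf.
Qed.

(** Perturbing f in the direction of such a g increases the norm by o(t) only,
    since g is small wherever |f| is close to ||f||; a support functional, being
    bounded by the norm, must then vanish at g. *)
Lemma support_functional_eq0 f g x0 (phi : C0 K X -> K) :
  norm_attaining_set f `<=` [set x0] -> support_functionals f phi ->
  g x0 = 0 -> phi g = 0.
Proof.
move=> fx0 [[lphi _] phi1 phif] gx0.
apply/eqP/negPn/negP => phig0.
have p0 : 0 < `|phi g| by rewrite normr_gt0.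
pose e := `|phi g| / 2; have e0 : 0 < e by rewrite divr_gt0.
have flt x : e <= `|g x| -> `|f x| < `|f|.
  move=> egx; rewrite lt_neqAle C0_norm_eval_le andbT.
  apply/eqP => /fx0 xx0; move: egx.
  by rewrite xx0 gx0 normr0 (lt_geF e0).
have [d d0 fd] := compact_norm_lt_gap (@C0_continuous f) (@C0_vanishes g _ e0) flt.
(* The size s of the perturbation keeps s |g| within the gap d; adding 1 to the
   denominator avoids a case distinction. *)
have g1 : 0 < `|g| + 1 by rewrite ltr_wpDl.
pose s := d / (`|g| + 1); have s0 : 0 < s by rewrite divr_gt0.
have sg : s * `|g| <= d.
  by rewrite mulrAC ler_pdivrMr// ler_wpM2l ?ltW// ltrDl.
(* This phase makes t * phi g equal to s * |phi g|, hence real. *)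
pose t := s * (`|phi g| / phi g).
have tE : `|t| = s.
  rewrite normrM (gtr0_norm s0) [X in _ * X]normf_div normr_id.
  by rewrite divff ?normr_eq0// mulr1.
have nle : `|t *: g + f| <= s * e + `|f|.
  apply: C0_norm_le => [|x]; first by rewrite addr_ge0// mulr_ge0 ?ltW.
  rewrite (le_trans (ler_normD _ _))// normrM tE.
  have [x1|x1] := boolP (e <= `|g x|).
    rewrite (@le_trans _ _ (d + (`|f| - d)))//.
      rewrite lerD ?fd// (le_trans _ sg)//.
      by rewrite ler_wpM2l ?(ltW s0)// C0_norm_eval_le.
    by rewrite addrCA subrr addr0 lerDr mulr_ge0 ?ltW.
  rewrite lerD ?C0_norm_eval_le// ler_wpM2l ?ltW//.
  by rewrite real_ltNge// ?normr_real ?gtr0_real.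
have := le_trans (dual_norm1_le lphi phi1 (t *: g + f)) nle.
rewrite lphi phif /t -mulrA divfK//.
rewrite ger0_norm; last by rewrite addr_ge0// mulr_ge0// ltW.
rewrite lerD2r ler_pM2l// /e {1}(splitr `|phi g|) gerDl.
by rewrite (lt_geF e0).
Qed.

Lemma C0_mul_bounded f (h : X -> K) : continuous h ->
  (forall x, `|h x| <= 1) -> exists g, forall x, g x = f x * h x.
Proof.
move=> ch h1; have cfh : continuous (fun x => f x * h x).
  by move=> x; apply: cvgM; [exact: C0_continuous|exact: ch].
suff fhP : (fun x => f x * h x) \in @C0_pred K X by exists (MkC0 fhP).
rewrite inE; split=> // e e0.
apply: subclosed_compact (closed_le_norm cfh e0) (@C0_vanishes f _ e0) _ => x /= ex.
rewrite (le_trans ex)// normrM.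
by rewrite ler_piMr.
Qed.

(** Locally compact Hausdorff spaces are completely regular, as subspaces of
    their compact one-point compactification. *)
Lemma scalars_urysohn (x y : X) :
  hausdorff_space X -> locally_compact [set: X] -> x <> y ->
  exists h : X -> K,
    [/\ continuous h, forall z, `|h z| <= 1, h x = 0 & h y = 1].
Proof.
move=> hX lX xy.
have cy : closed [set y].
  exact: accessible_closed_set1 (hausdorff_accessible hX) y.
have /(@uniform_separatorP _ R)[u [cu u01 u0 u1]] :=
  @locally_compact_completely_regular X R lX hX x _ cy xy.
have [iota [ci i0 i1 ib]] := real_to_scalars R k.
exists (iota \o u); split=> /=.
- by move=> z; apply: continuous_comp; [exact: cu|exact: ci].
- move=> z; apply: ib.
  by have := u01 (u z) (ex_intro2 _ _ z I erefl); rewrite /= in_itv.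
- by rewrite (imsub1 u0).
- by rewrite (imsub1 u1).
Qed.

End C0_smoothness.

Theorem theorem1p1p3 (R : realType) (k : scalar_kind) (X : topologicalType)
    (hausX : hausdorff_space X) (lcX : locally_compact [set: X])
    (f : C0 (scalars R k) X) (f_neq0 : f != 0) :
  smooth f <-> singleton_set (norm_attaining_set f).
Proof.
have N0 : `|f| != 0 by rewrite normr_eq0.
split=> [[_ [phi Jphi]]|[x0 Mf]].
  have [x Mx] := norm_attaining_set_neq0 f_neq0.
  exists x; apply/seteqP; split=> [y My|_ ->//]; apply: contrapT => /= yx.
  have [h [ch h1 hy hx]] := scalars_urysohn R k hausX lcX yx.
  have [g gE] := C0_mul_bounded f ch h1.
  have Jpoint z : norm_attaining_set f z -> phi g = `|f| * h z.
    move=> Mz; have /= := point_support_functional f_neq0 Mz.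
    rewrite Jphi => <-.
    rewrite gE mulrA divfK//.
    by rewrite -normr_eq0 Mz.
  have := Jpoint y My; rewrite (Jpoint x Mx) hx hy mulr0 mulr1.
  by move/eqP; rewrite (negPf N0).
have Mx0 : norm_attaining_set f x0 by rewrite Mf.
have fx0 : f x0 != 0 by rewrite -normr_eq0 Mx0.
split=> //; exists (fun g : C0 (scalars R k) X => `|f| / f x0 * g x0).
apply/seteqP; split=> [phi Jphi|_ ->]; last exact: point_support_functional.
have sub : norm_attaining_set f `<=` [set x0] by rewrite Mf.
have [[lphi _] _ phif] := Jphi.
apply/funext => g.
(* Removing from g its component along f leaves a function vanishing at x0. *)
have g0 : (- (g x0 / f x0) *: f + g) x0 = 0.
  by rewrite -[LHS]/(- (g x0 / f x0) * f x0 + g x0) mulNr divfK// addNr.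
have /eqP := support_functional_eq0 sub Jphi g0.
rewrite lphi phif addrC mulNr subr_eq0 => /eqP ->.
by rewrite mulrC mulrAC mulrA.
Qed.
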